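(* Let $X$ be a doubling metric space with $X=\bigcup_{j=1}^n\overline{X}_j$, where $X_1,\dots,X_n$ are pairwise disjoint subsets of $X$, each of which is cube-decomposable in $X$, and $\overline{X}_j$ is the closure of $X_j$ in $X$. Then $X$ is cube-decomposable.
   Context: $B(x,R)$ denotes the open ball. A metric space $X$ is doubling if there is a constant $N>0$ such that for each $x\in X$ and $r>0$ the ball $B(x,2r)$ can be covered by at most $N$ balls of radius $r$. A family of dyadic cubes of a metric space $(X,\rho)$ is a collection of subsets $Q_\alpha^k\subset X$, $k\in\mathbb{N}_0$, $\alpha\in I_k$ ($I_k$ index sets), for which there exist a ball constant $C>0$ and a scaling value $\delta\in(0,1)$ such that: (a) $X=\bigsqcup_{\alpha\in I_k}Q_\alpha^k$ for each $k\in\mathbb{N}_0$; (b) for each $l\ge k$, $\alpha\in I_l$, $\beta\in I_k$, either $Q_\alpha^l\subset Q_\beta^k$ or $Q_\alpha^l\cap Q_\beta^k=\emptyset$; (c) for each $Q_\alpha^k$ there is a point $x_\alpha^k\in Q_\alpha^k$ with $B(x_\alpha^k,C^{-1}\delta^k)\subseteq Q_\alpha^k\subseteq B(x_\alpha^k,C\delta^k)$. The family is connected if, in addition, (d) each $Q_\alpha^k$ is a connected subset of $X$. $X$ is cube-decomposable if it has a connected family of dyadic cubes. A subset $Y\subset X$ is cube-decomposable in $X$ if $Y$, with the restricted metric, has a connected family of dyadic cubes such that (c) holds with the inner ball $B(x_\alpha^k,C^{-1}\delta^k)$ taken in $X$ (not just in $Y$). *)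

(* Defs.v *)
From HB Require Import structures.
From mathcomp Require Import all_boot all_order all_algebra.
From mathcomp Require Import boolp classical_sets reals topology.

Set Implicit Arguments.
Unset Strict Implicit.
Unset Printing Implicit Defensive.

Import Order.TTheory GRing.Theory Num.Theory.

Local Open Scope classical_set_scope.
Local Open Scope ring_scope.

Definition doubling (R : realType) (X : metricType R) : Prop :=
  exists2 N : nat, (0 < N)%N &
    forall (x : X) (r : R), 0 < r ->
      exists2 s : seq X, (size s <= N)%N &
        ball x (2 * r) `<=` \bigcup_(y in [set` s]) ball y r.

(* Dyadic cubes of the subset [Y], with inner balls taken in the whole of [X].
   Each cube is contained in [Y] by the covering clause, so its containment in
   an outer ball of the restricted metric, [Y `&` ball x r], is the same as its
   containment in [ball x r]. For [Y = setT] this is the notion of a family of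
   dyadic cubes of [X] itself. *)
Definition dyadic_cubes (R : realType) (X : metricType R) (Y : set X)
    (I : nat -> Type) (Q : forall k : nat, I k -> set X) : Prop :=
  exists C delta : R,
    [/\ 0 < C,
        0 < delta < 1,
        forall k : nat,
          Y = \bigcup_(a in [set: I k]) Q k a /\ trivIset [set: I k] (Q k),
        forall (k l : nat) (a : I l) (b : I k), (k <= l)%N ->
          Q l a `<=` Q k b \/ Q l a `&` Q k b = set0
      & forall (k : nat) (a : I k), exists x : X,
          [/\ Q k a x,
              ball x (C^-1 * delta ^+ k) `<=` Q k a
            & Q k a `<=` ball x (C * delta ^+ k)]].

(* [connected] only involves the topology induced on the cube, so it does not
   matter whether a cube is regarded as a subset of [Y] or of [X]. *)
Definition connected_dyadic_cubes (R : realType) (X : metricType R)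
    (Y : set X) (I : nat -> Type) (Q : forall k : nat, I k -> set X) : Prop :=
  dyadic_cubes Y Q /\ forall (k : nat) (a : I k), connected (Q k a).

Definition cube_decomposable_in (R : realType) (X : metricType R)
    (Y : set X) : Prop :=
  exists (I : nat -> Type) (Q : forall k : nat, I k -> set X),
    connected_dyadic_cubes Y Q.

Definition cube_decomposable (R : realType) (X : metricType R) : Prop :=
  cube_decomposable_in [set: X].

(* Main.v *)
(* After passing to the levels [m k] with [delta_j ^ m k] comparable to [2^-k],
   the cubes of all the [X_j] have a common scaling value, and together they are
   connected dyadic cubes of the dense set [Y], the union of the [X_j]. To reach
   the points outside [Y], attach to each [x] an ultrafilter [F x] on [Y]
   converging to [x], principal when [x] is in [Y], and enlarge a cube [Q] to
   [{x | Q in F x}]. The new cube lies between [Q] and its closure, so it is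
   connected; nesting and disjointness pass through the filters. Doubling makes
   the cubes of a given level locally finite, so [F x], being an ultrafilter,
   contains one of them: the new cubes cover [X]. *)
Require Import Defs.
From HB Require Import structures.
From mathcomp Require Import all_boot all_order all_algebra.
From mathcomp Require Import boolp classical_sets reals topology.
From mathcomp Require Import normedtype sequences.

Set Implicit Arguments.
Unset Strict Implicit.
Unset Printing Implicit Defensive.

Import Order.TTheory GRing.Theory Num.Theory.
Import numFieldNormedType.Exports.

Local Open Scope classical_set_scope.
Local Open Scope ring_scope.

(** A nonempty relatively clopen part [U] of [B] meets [A], which is dense in [B]. Its trace on [A]
    is clopen there, hence all of [A]; being closed in [B], [U] then fills [B]. *)
Lemma connected_between_closure (T : topologicalType) (A B : set T) :
  connected A -> A `<=` B -> B `<=` closure A -> connected B.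
Proof.
move=> cA AB BclA U U0 [C1 oC1 UC1] [C2 cC2 UC2].
have AU : A `&` U = A.
  apply: cA.
  - move: U0; rewrite UC1 => -[z [Bz C1z]].
    have [w [Aw C1w]] : A `&` C1 !=set0.
      by apply: (BclA _ Bz); exact: open_nbhs_nbhs.
    by exists w; split=> //; split=> //; exact: AB.
  - by exists C1 => //; rewrite UC1 setIA (setIidl AB).
  - by exists C2 => //; rewrite UC2 setIA (setIidl AB).
apply/seteqP; split=> [z|z Bz]; first by rewrite UC2 => -[].
rewrite UC2; split=> //; apply: cC2; apply: closureS (BclA _ Bz) => y.
by rewrite -AU UC2 => -[_ []].
Qed.

Lemma ultra_bigcup_seq (T : Type) (J : eqType) (F : set_system T)
    (S : J -> set T) (s : seq J) : UltraFilter F ->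
  F (\bigcup_(y in [set` s]) S y) -> exists2 y, y \in s & F (S y).
Proof.
move=> FU; elim: s => [|y s IHs] Fs.
  by have [t [z]] := filter_ex Fs.
have [FS|FnS] := in_ultra_setVsetC (S y) FU.
  by exists y => //; rewrite mem_head.
have /IHs[z zs FSz] : F (\bigcup_(z in [set` s]) S z).
  apply: filterS (filterI Fs FnS) => t [[z /=]].
  by rewrite inE => /predU1P[->//|zs Sz _]; exists z.
by exists z => //; rewrite inE zs orbT.
Qed.

Lemma closure_ultra (T : topologicalType) (Y : set T) (x : T) :
  closure Y x ->
  exists F : set_system T,
    [/\ UltraFilter F, F --> x, F Y & Y x -> F = principal_filter x].
Proof.
move=> clYx; have [Yx|nYx] := pselect (Y x).
  exists (principal_filter x); split=> //.
  - exact: principal_filter_ultra.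
  - by move=> A /nbhs_singleton Ax; exact/principal_filterP.
  - exact/principal_filterP.
have [F [FU YF]] := ultraFilterLemma (within_nbhs_proper clYx).
exists F; split=> //; last by apply: YF; exact: withinT.
by move=> A xA; apply: YF; exact: cvg_within xA.
Qed.

Lemma doubling_cover (R : realType) (X : metricType R) (x : X) (r e : R) :
  doubling X -> 0 < e ->
  exists s : seq X, ball x r `<=` \bigcup_(y in [set` s]) ball y e.
Proof.
move=> [N _ dX] e0.
suff cover m (z : X) :
    exists s : seq X, ball z (2 ^+ m * e) `<=` \bigcup_(y in [set` s]) ball y e.
  (* This exponent [m] satisfies [r / e < 2 ^+ m]. *)
  have [s xs] := cover (Num.Def.archi_bound (r / e)) x.
  exists s => z xz; apply: xs; apply: le_ball xz.
  by rewrite -ler_pdivrMr// ltW// upper_nthrootP.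
elim: m z => [|m IHm] z.
  by exists [:: z] => y; rewrite expr0 mul1r => zy; exists z => //=; rewrite inE.
have [|s _ zs] := dX z (2 ^+ m * e); first by rewrite mulr_gt0// exprn_gt0.
have [t tP] := choice IHm.
exists (flatten [seq t y | y <- s]) => w; rewrite exprS -mulrA => /zs[y /= ys].
move=> /tP[v /= vt vw]; exists v => //=.
by apply/flattenP; exists (t y) => //; exact: map_f.
Qed.

(** The constants are parameters so that several families can be given the same ones before they are
    merged. *)
Definition scaled_cubes (R : realType) (X : metricType R) (C delta : R)
    (Y : set X) (I : nat -> Type) (Q : forall k : nat, I k -> set X) : Prop :=
  [/\ forall k, Y = \bigcup_(a in [set: I k]) Q k a /\ trivIset [set: I k] (Q k),
      forall (k l : nat) (a : I l) (b : I k), (k <= l)%N ->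
        Q l a `<=` Q k b \/ Q l a `&` Q k b = set0,
      forall (k : nat) (a : I k), exists x : X,
        [/\ Q k a x,
            ball x (C^-1 * delta ^+ k) `<=` Q k a
          & Q k a `<=` ball x (C * delta ^+ k)]
    & forall (k : nat) (a : I k), connected (Q k a)].

Lemma cube_decomposable_inP (R : realType) (X : metricType R) (Y : set X) :
  cube_decomposable_in Y <->
  exists C delta (I : nat -> Type) (Q : forall k, I k -> set X),
    [/\ 0 < C, 0 < delta < 1 & scaled_cubes C delta Y Q].
Proof.
split=> [[I [Q [[C [d [C0 d01 YQ QQ xQ]]] cQ]]]|].
  by exists C, d, I, Q; split.
move=> [C [d [I [Q [C0 d01 [YQ QQ xQ cQ]]]]]].
by exists I, Q; split=> //; exists C, d; split.
Qed.

(** Take for [m k] the least [n] with [d ^+ n <= e ^+ k]. By minimality the preceding power of [d]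
    exceeds [e ^+ k], which costs one factor [d] in the lower bound. *)
Lemma geometric_levels (R : realType) (d e : R) :
  0 < d < 1 -> 0 < e < 1 ->
  exists2 m : nat -> nat, {homo m : k l / (k <= l)%N} &
    forall k, d * e ^+ k <= d ^+ m k <= e ^+ k.
Proof.
move=> /andP[d0 d1] /andP[e0 e1].
have ex k : exists n, d ^+ n <= e ^+ k.
  have /cvgr0_norm_lt/(_ (e ^+ k)) : d ^+ n @[n --> \oo] --> 0.
    by apply: cvg_expr; rewrite ger0_norm// ltW.
  rewrite exprn_gt0// => /(_ erefl)[n _ /(_ n (leqnn n))]/=.
  by rewrite ger0_norm ?exprn_ge0 ?ltW// => /ltW den; exists n.
exists (fun k => ex_minn (ex k)) => [k l kl|k].
  case: ex_minnP => i _; apply; case: ex_minnP => j dj _.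
  by apply: le_trans dj _; rewrite ler_wiXn2l// ltW.
(* If the least exponent is 0 there is no preceding power, but [d * e ^+ k <= 1] holds anyway. *)
case: ex_minnP => -[d0e _|j dj jmin]; apply/andP; split=> //.
- by rewrite expr0 mulr_ile1 ?exprn_ge0 ?exprn_ile1 ?ltW.
- by rewrite exprS ler_pM2l// leNgt; apply/negP => /ltW/jmin; rewrite ltnn.
Qed.

(** Levels of the old family may be skipped or repeated; nesting survives since [m] is monotone.
    Dividing [C] by [d] absorbs the factor lost in the inner radius. *)
Lemma scaled_cubes_rescale (R : realType) (X : metricType R) (C d e : R)
    (Y : set X) (I : nat -> Type) (Q : forall k, I k -> set X) :
  0 < C -> 0 < d < 1 -> 0 < e < 1 -> scaled_cubes C d Y Q ->
  exists (J : nat -> Type) (P : forall k, J k -> set X),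
    scaled_cubes (C / d) e Y P.
Proof.
move=> C0 d01 e01 [YQ QQ xQ cQ].
have [m mle mP] := geometric_levels d01 e01.
have [/andP[d0 d1] /andP[e0 e1]] := (d01, e01).
exists (fun k => I (m k)), (fun k => Q (m k)); split=> //.
- by move=> k l a b kl; apply: QQ; exact: mle.
move=> k a; have [x [Qx xQa Qax]] := xQ (m k) a; exists x.
have /andP[dek dke] := mP k; split=> // y.
- move=> xy; apply: xQa; apply: le_ball xy.
  by rewrite invf_div mulrAC mulrC ler_pM2l// invr_gt0.
- move=> /Qax; apply: le_ball; rewrite -mulrA ler_pM2l//.
  apply: (le_trans dke); rewrite ler_peMl ?exprn_ge0 ?ltW//.
  by rewrite invf_gt1.
Qed.

Lemma scaled_cubes_le (R : realType) (X : metricType R) (C D d : R)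
    (Y : set X) (I : nat -> Type) (Q : forall k, I k -> set X) :
  0 < C -> C <= D -> 0 < d -> scaled_cubes C d Y Q -> scaled_cubes D d Y Q.
Proof.
move=> C0 CD d0 [YQ QQ xQ cQ]; split=> // k a.
have [x [Qx xQa Qax]] := xQ k a; exists x; split=> // y.
- move=> xy; apply: xQa; apply: le_ball xy.
  by rewrite ler_pM2r ?exprn_gt0// lef_pV2// posrE (lt_le_trans C0).
- by move=> /Qax; apply: le_ball; rewrite ler_pM2r ?exprn_gt0.
Qed.

Lemma cube_decomposable_in_bigcup (R : realType) (X : metricType R) (n : nat)
    (Xs : 'I_n -> set X) :
  (forall i j, i != j -> Xs i `&` Xs j = set0) ->
  (forall j, cube_decomposable_in (Xs j)) ->
  cube_decomposable_in (\bigcup_(j in [set: 'I_n]) Xs j).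
Proof.
move=> disjX decX; pose e : R := 2^-1.
have e01 : 0 < e < 1 by rewrite invr_gt0 ltr0n invf_lt1// ltr1n.
have /choice[C CP] j : exists C : R, 0 < C /\
    exists (I : nat -> Type) (Q : forall k, I k -> set X),
      scaled_cubes C e (Xs j) Q.
  have /cube_decomposable_inP[C [d [I [Q [C0 d01 QP]]]]] := decX j.
  exists (C / d); split; first by case/andP: d01 => d0 _; rewrite divr_gt0.
  exact: scaled_cubes_rescale QP.
have /choice[I /(_ _)/cid IP] j := (CP j).2.
pose Q j := projT1 (IP j); have QP j : scaled_cubes (C j) e (Xs j) (Q j).
  exact: projT2 (IP j).
(* The sum dominates every [C j]; the summand 1 keeps [D] positive even when [n = 0]. *)
pose D := 1 + \sum_j C j.
have C0 j : 0 < C j := (CP j).1.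
have CD j : C j <= D.
  rewrite /D (bigD1 j)//= addrCA lerDl addr_ge0// sumr_ge0// => i _.
  exact: ltW.
have {}QP j : scaled_cubes D e (Xs j) (Q j).
  by apply: scaled_cubes_le (QP j) => //; case/andP: e01.
have QX j k a : Q j k a `<=` Xs j.
  by case: (QP j) => /(_ k)[-> _] _ _ _ x Qx; exists a.
apply/cube_decomposable_inP; exists D, e, (fun k => {j & I j k}).
exists (fun k a => Q (projT1 a) k (projT2 a)); split=> //.
  by rewrite ltr_wpDr// sumr_ge0// => j _; exact: ltW.
split.
- move=> k; split.
    apply/seteqP; split=> x [].
      move=> j _; case: (QP j) => /(_ k)[-> _] _ _ _ [a _ Qx].
      by exists (existT _ j a).
    by move=> [j a] _ /QX Xx; exists j.
  move=> [i a] [j b] _ _ [x [/= Qa Qb]].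
  have [ij|/disjX ij0] := eqVneq i j; last first.
    have : (Xs i `&` Xs j) x by split; [exact: QX Qa|exact: QX Qb].
    by rewrite ij0.
  case: j / ij b Qb => b Qb; congr existT.
  by case: (QP i) => /(_ k)[_ tQ] _ _ _; apply: tQ => //; exists x.
- move=> k l [i a] [j b] kl /=.
  have [ij|/disjX ij0] := eqVneq i j; last first.
    by right; apply/seteqP; split=> // x [/QX Xi /QX Xj]; rewrite -ij0.
  by case: j / ij b => b; case: (QP i) => _ + _ _; exact.
- by move=> k [j a]; case: (QP j) => _ _ /(_ k a).
- by move=> k [j a]; case: (QP j) => _ _ _ /(_ k a).
Qed.

Lemma scaled_cubes_ultra (R : realType) (X : metricType R) (C d : R)
    (Y : set X) (I : nat -> Type) (Q : forall k, I k -> set X)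
    (F : set_system X) (x : X) (k : nat) :
  doubling X -> 0 < C -> 0 < d -> scaled_cubes C d Y Q ->
  UltraFilter F -> F --> x -> F Y -> exists a, F (Q k a).
Proof.
move=> dX C0 d0 [/(_ k)[YQ tQ] _ /(_ k) xQ _] FU Fx FY.
have dk0 : 0 < d ^+ k by rewrite exprn_gt0.
(* Half the inner radius: two centres in one ball of radius [e] lie in each other's inner balls. *)
pose e := C^-1 * d ^+ k / 2.
have e0 : 0 < e by rewrite divr_gt0// mulr_gt0// invr_gt0.
(* This ball contains the centre of every cube that meets [ball x 1], a set belonging to [F]. *)
have [s xs] := doubling_cover x (1 + C * d ^+ k) dX e0.
have [c cP] := choice xQ.
(* The points of [Y] whose cube has its centre in [ball y e]. Distinct cubes
   have centres at distance at least [2 * e], so this is at most one cube. *)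
pose S y := [set z | exists2 a, Q k a z & ball y e (c a)].
have [|y _ FS] := @ultra_bigcup_seq _ _ F S s FU.
  have FxY : F (Y `&` ball x 1).
    by apply: filterI => //; apply: Fx; exact: nbhsx_ballx.
  apply: filterS FxY => z []; rewrite {1}YQ => -[a _ Qz] xz.
  have /xs[y ys yc] : ball x (1 + C * d ^+ k) (c a).
    apply: ball_triangle xz _; apply: ball_sym.
    by have [_ _] := cP a; exact.
  by exists y => //; exists a.
have [z [a Qz ya]] := filter_ex FS; exists a; apply: filterS FS => w [b Qw yb].
suff -> : a = b by [].
apply: tQ => //; exists (c b); split; last by case: (cP b).
have [_ + _] := cP a; apply; rewrite [_ * _]splitr.
by apply: ball_triangle yb; exact: ball_sym.
Qed.

Lemma cube_decomposable_dense (R : realType) (X : metricType R) (Y : set X) :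
  doubling X -> (forall x, closure Y x) -> cube_decomposable_in Y ->
  cube_decomposable X.
Proof.
move=> dX Yd /cube_decomposable_inP[C [d [I [Q [C0 d01 QP]]]]].
have /andP[d0 d1] := d01.
have [YQ QQ xQ cQ] := QP.
have /choice[F FP] x := closure_ultra (Yd x).
have FU x : UltraFilter (F x) by case: (FP x).
pose P k a := [set x | F x (Q k a)].
have QX k a : Q k a `<=` Y.
  by have [-> _] := YQ k => x Qx; exists a.
have QsubP k a : Q k a `<=` P k a.
  move=> x Qx; have [_ _ _ Fx] := FP x.
  by rewrite /P /= Fx; [exact/principal_filterP|exact: QX Qx].
have PclQ k a : P k a `<=` closure (Q k a).
  move=> x FQ B xB; have [_ Fx _ _] := FP x.
  exact: filter_ex (filterI FQ (Fx _ xB)).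
(* The factor 2 makes room for the limit points added to the cubes. *)
apply/cube_decomposable_inP; exists (2 * C), d, I, P; split=> //.
  by rewrite mulr_gt0.
split.
- move=> k; split.
    apply/seteqP; split=> x // _; have [_ Fx FY _] := FP x.
    by have [a Fa] := scaled_cubes_ultra k dX C0 d0 QP (FU x) Fx FY; exists a.
  move=> a b _ _ [x [Fa Fb]]; have [_ tQ] := YQ k.
  by apply: tQ => //; exact: filter_ex (filterI Fa Fb).
- move=> k l a b /(QQ _ _ a b)[QaQb|Qab0]; first left=> x; first exact: filterS.
  right; apply/seteqP; split=> // x [Fa Fb].
  have [y] := filter_ex (filterI Fa Fb).
  by rewrite Qab0.
- move=> k a; have [x [Qx xQa Qax]] := xQ k a; exists x.
  have dk0 : 0 < d ^+ k by rewrite exprn_gt0.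
  (* The inner ball is taken in [X] and already lies in [Q k a], so it survives the enlargement. For
     the outer ball, a point [y] of [P k a] is within [C * d ^+ k] of some point of [Q k a]. *)
  split=> [|y xy|y /PclQ Qy]; first exact: QsubP.
    apply/QsubP/xQa; apply: le_ball xy; rewrite ler_pM2r//.
    by rewrite lef_pV2 ?posrE ?mulr_gt0// ler_peMl ?ltW// ltr1n.
  have [|z [/Qax xz yz]] := Qy (ball y (C * d ^+ k)).
    by apply: nbhsx_ballx; rewrite mulr_gt0.
  rewrite -mulrA mulr_natl mulr2n.
  by apply: ball_triangle xz _; exact: ball_sym.
- by move=> k a; apply: connected_between_closure (cQ k a) _ _.
Qed.

Theorem corollary4p7 (R : realType) (X : metricType R) (n : nat)
    (Xs : 'I_n -> set X)
    (doublingX : doubling X)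
    (coverX : [set: X] = \bigcup_(j in [set: 'I_n]) closure (Xs j))
    (disjX : forall i j : 'I_n, i != j -> Xs i `&` Xs j = set0)
    (decX : forall j : 'I_n, cube_decomposable_in (Xs j)) :
  cube_decomposable X.
Proof.
apply: cube_decomposable_dense (cube_decomposable_in_bigcup disjX decX) => // x.
have [j _ clx] : (\bigcup_(j in [set: 'I_n]) closure (Xs j)) x by rewrite -coverX.
by apply: closureS clx => y Xy; exists j.
Qed.
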